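(* Let $n\ge1$, let $\theta\in\mathbb{R}$ be fixed, and let $\alpha_0,\dots,\alpha_{n-2}$ be complex numbers of modulus $<1$. For $s=(s_1,\dots,s_{n-1})\in\{0,1\}^{n-1}$ let $\mathcal{S}_{n-1}=\mathcal{S}_{n-1}(s)$ be the $n\times n$ unitary snake-shaped matrix with parameter $\theta$ and shape $s$. Then the eigenvalues and the first components of the normalized eigenvectors of $\mathcal{S}_{n-1}(s)$ depend on the Schur parameters (and $\theta$) but not on the shape $s$ of the snake. That is, for any $s,s'\in\{0,1\}^{n-1}$, $\mathcal{S}_{n-1}(s)$ and $\mathcal{S}_{n-1}(s')$ have the same eigenvalues, and for each eigenvalue $\lambda$ the first component of the normalized eigenvector of $\mathcal{S}_{n-1}(s)$ for $\lambda$ equals the first component of the normalized eigenvector of $\mathcal{S}_{n-1}(s')$ for $\lambda$.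
   Context: Rows and columns of $n\times n$ matrices are indexed $0,\dots,n-1$; the first component of a vector is the one of index $0$. Put $\rho_k=\sqrt{1-|\alpha_k|^2}$. For $0\le k\le n-2$ let $G_{k,k+1}$ be the $n\times n$ matrix equal to the identity except that its block in rows and columns $\{k,k+1\}$ is $\begin{bmatrix}\overline{\alpha_k}&\rho_k\\ \rho_k&-\alpha_k\end{bmatrix}$, and let $D_\theta=\mathrm{diag}(1,\dots,1,e^{i\theta})$. The matrix $\mathcal{S}_{n-1}(s)$ is built as follows. If $n=1$, $\mathcal{S}_0=[e^{i\theta}]$. If $n\ge2$, start with $T^{(0)}=G_{0,1}$; for $k=1,\dots,n-2$ put $T^{(k)}=T^{(k-1)}G_{k,k+1}$ if $s_k=0$ and $T^{(k)}=G_{k,k+1}T^{(k-1)}$ if $s_k=1$; finally $\mathcal{S}_{n-1}(s)=T^{(n-2)}D_\theta$ if $s_{n-1}=0$ and $\mathcal{S}_{n-1}(s)=D_\theta T^{(n-2)}$ if $s_{n-1}=1$. (Equivalently, this is the principal $n\times n$ submatrix of the infinite snake-shaped product in which the $2\times2$ block of the factor $G_{n-1,n}$ is replaced by $\mathrm{diag}(e^{i\theta},e^{i\tilde\theta})$, $\tilde\theta\in\mathbb{R}$ arbitrary.) Normalized eigenvectors: the eigenvectors are scaled so that they form an orthonormal system and their first components are real positive numbers. *)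

(* Defs.v *)
From HB Require Import structures.
From mathcomp Require Import all_boot all_order all_algebra.
From mathcomp Require Import complex.
From mathcomp Require Import reals trigo.

Set Implicit Arguments.
Unset Strict Implicit.
Unset Printing Implicit Defensive.

Import Order.TTheory GRing.Theory Num.Theory.
Local Open Scope ring_scope.
Local Open Scope sesquilinear_scope.

(* Matrices have size n.+1, so a matrix of size N >= 1 has n = N - 1 Schur
   parameters alpha_0, ..., alpha_(N-2) and n shape bits s_1, ..., s_(N-1).
   The tuple alpha is indexed from 0 as is; the bit s_k sits at position k.-1
   of the tuple s, with true standing for 1. *)

Definition expi (R : realType) (theta : R) : R[i] :=
  Complex (cos theta) (sin theta).

Definition rho (R : realType) (a : R[i]) : R[i] := sqrtC (1 - `|a| ^+ 2).

Definition givens (R : realType) (n : nat) (a : R[i]) (k : nat) :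
    'M[R[i]]_n.+1 :=
  \matrix_(i, j)
    if (i == k :> nat) && (j == k :> nat) then a^*
    else if (i == k :> nat) && (j == k.+1 :> nat) then rho a
    else if (i == k.+1 :> nat) && (j == k :> nat) then rho a
    else if (i == k.+1 :> nat) && (j == k.+1 :> nat) then - a
    else (i == j)%:R.

Definition phase (R : realType) (n : nat) (theta : R) : 'M[R[i]]_n.+1 :=
  diag_mx (\row_j (if j == ord_max then expi theta else 1)).

Fixpoint snake_prod (R : realType) (n : nat) (alpha : n.-tuple R[i])
    (s : n.-tuple bool) (k : nat) : 'M[R[i]]_n.+1 :=
  match k with
  | 0 => givens n alpha`_0 0
  | k'.+1 =>
      (* nth false s k' is s_(k'+1) *)
      if nth false s k' then givens n alpha`_(k'.+1) k'.+1 *m snake_prod alpha s k'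
      else snake_prod alpha s k' *m givens n alpha`_(k'.+1) k'.+1
  end.

(* For n > 0 the last bit s_(N-1) is at position n.-1, and n.-1 = N - 2 is also
   the index of the last partial product. *)
Definition snake (R : realType) (n : nat) (theta : R) (alpha : n.-tuple R[i])
    (s : n.-tuple bool) : 'M[R[i]]_n.+1 :=
  if n == 0%N then phase n theta
  else if nth false s n.-1 then phase n theta *m snake_prod alpha s n.-1
  else snake_prod alpha s n.-1 *m phase n theta.

(* The columns of V are the eigenvectors.  On R[i], 0 < z means that z is real
   and positive. *)
Definition normalized_eigensystem (R : realType) (n : nat)
    (A : 'M[R[i]]_n.+1) (d : 'I_n.+1 -> R[i]) (V : 'M[R[i]]_n.+1) : Prop :=
  [/\ forall j, A *m col j V = d j *: col j V,
      V^t* *m V = 1%:M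
    & forall j, 0 < V ord0 j].

Definition normalized_eigenvector (R : realType) (n : nat)
    (A : 'M[R[i]]_n.+1) (lambda : R[i]) (x : 'cV[R[i]]_n.+1) : Prop :=
  exists d V j,
    [/\ normalized_eigensystem A d V, d j = lambda & col j V = x].

(* Main.v *)
(* Flipping one bit s_k turns a product T B into B T, where B collects the
   factors of index > k.  These two are conjugate by B, a unitary matrix that
   fixes the first basis vector, so conjugation by B preserves eigenvalues and
   first components of normalized eigenvectors.  Existence and uniqueness of the
   normalized eigenvectors then only need to be checked for the zero shape,
   where an eigenvector with zero first component vanishes entry by entry. *)

Require Import Defs.
From mathcomp Require Import all_boot all_order all_algebra.
From mathcomp Require Import complex.
From mathcomp Require Import reals trigo.
From mathcomp Require Import ring zify.

Set Implicit Arguments.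
Unset Strict Implicit.
Unset Printing Implicit Defensive.

Import Order.TTheory GRing.Theory Num.Theory.
Local Open Scope ring_scope.
Local Open Scope sesquilinear_scope.

(** * Ladder products in a ring and their splitting *)

Fixpoint ladder (R : pzRingType) (G : nat -> R) (s : nat -> bool) (k : nat) : R :=
  match k with
  | 0 => G 0%N
  | k'.+1 => if s k' then G k'.+1 * ladder G s k' else ladder G s k' * G k'.+1
  end.

(** The same kind of product for the indices [k] to [k + m], but peeled from its lowest factor. The
    bit [s k] again places [G k.+1] relative to [G k], and the tail above index [k] is available as
    a single factor. *)
Fixpoint ladder_from (R : pzRingType) (G : nat -> R) (s : nat -> bool)
    (k m : nat) : R :=
  match m with
  | 0 => G k
  | m'.+1 => if s k then ladder_from G s k.+1 m' * G k
             else G k * ladder_from G s k.+1 m'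
  end.

Lemma comm_ladder (R : pzRingType) (G : nat -> R) s k x :
  (forall j, (j <= k)%N -> GRing.comm x (G j)) -> GRing.comm x (ladder G s k).
Proof.
elim: k => [|k IHk] xG /=; first exact: xG.
have {}IHk : GRing.comm x (ladder G s k) by apply: IHk => j jk; exact/xG/leqW.
by case: (s k); apply: commrM => //; apply: xG.
Qed.

Lemma comm_ladder_from (R : pzRingType) (G : nat -> R) s k m x :
  (forall j, (k <= j)%N -> GRing.comm x (G j)) ->
  GRing.comm x (ladder_from G s k m).
Proof.
elim: m k => [|m IHm] k xG /=; first exact: xG.
have {}IHm : GRing.comm x (ladder_from G s k.+1 m).
  by apply: IHm => j jk; exact/xG/ltnW.
by case: (s k); apply: commrM => //; apply: xG.
Qed.

(** Induction on [m] moves the factor [G k.+1] from the lower block to the upper one. If the bits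
    [s k] and [s k.+1] agree, this is associativity. If they differ, the tail from [k.+2] has to
    pass the block up to [k], and it does because all indices involved differ by at least 2. *)
Lemma ladder_split (R : pzRingType) (G : nat -> R) s k m :
  (forall i j, (i.+1 < j)%N -> GRing.comm (G i) (G j)) ->
  ladder G s (k + m).+1 =
    if s k then ladder_from G s k.+1 m * ladder G s k
    else ladder G s k * ladder_from G s k.+1 m.
Proof.
move=> commG; elim: m k => [|m IHm] k; first by rewrite addn0.
rewrite addnS -addSn IHm /=.
have comm_far : GRing.comm (ladder_from G s k.+2 m) (ladder G s k).
  apply: comm_ladder => i ik; apply/commr_sym/comm_ladder_from => j kj.
  by apply: commG; lia.
case: (s k); case: (s k.+1); rewrite ?mulrA //.
- by rewrite -mulrA -comm_far mulrA.
- by rewrite comm_far.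
Qed.

Lemma eq_ladder (R : pzRingType) (G : nat -> R) s s' k :
  (forall j, (j < k)%N -> s j = s' j) -> ladder G s k = ladder G s' k.
Proof.
elim: k => //= k IHk ss'; rewrite (ss' k) // IHk // => j jk.
by apply: ss'; apply: ltnW.
Qed.

Lemma eq_ladder_from (R : pzRingType) (G : nat -> R) s s' k m :
  (forall j, (k <= j)%N -> s j = s' j) ->
  ladder_from G s k m = ladder_from G s' k m.
Proof.
elim: m k => //= m IHm k ss'; rewrite (ss' k) // IHm // => j jk.
by apply: ss'; apply: ltnW.
Qed.

(** * Unitary matrices that fix initial coordinates, and similarity through them *)

Definition fixes_below (C : numClosedFieldType) (n k : nat) (U : 'M[C]_n.+1) :=
  U \is unitarymx /\
  forall i j : 'I_n.+1, (i < k)%N -> U i j = (i == j)%:R.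

Lemma fixes_below1 (C : numClosedFieldType) n k :
  fixes_below k (1 : 'M[C]_n.+1).
Proof.
split=> [|i j _]; last by rewrite mxE.
by apply/unitarymxP; rewrite trmx1 map_mx1 mulmx1.
Qed.

Lemma fixes_below_le (C : numClosedFieldType) n k l (U : 'M[C]_n.+1) :
  (k <= l)%N -> fixes_below l U -> fixes_below k U.
Proof. by move=> kl [uU rU]; split=> // i j ik; apply: rU; apply: leq_trans kl. Qed.

Lemma mul_fixes_below_l (C : numClosedFieldType) n p k (U : 'M[C]_n.+1)
    (M : 'M[C]_(n.+1, p)) (i : 'I_n.+1) j :
  fixes_below k U -> (i < k)%N -> (U *m M) i j = M i j.
Proof.
move=> [_ rU] ik; rewrite mxE (bigD1 i) //= rU // eqxx mul1r big1 ?addr0 //.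
by move=> l /negbTE li; rewrite rU // eq_sym li mul0r.
Qed.

Lemma fixes_belowM (C : numClosedFieldType) n k (U W : 'M[C]_n.+1) :
  fixes_below k U -> fixes_below k W -> fixes_below k (U * W).
Proof.
move=> fU [uW rW]; split; first by apply: mul_unitarymx uW; case: fU.
by move=> i j ik; rewrite (mul_fixes_below_l _ _ fU) ?rW.
Qed.

Lemma unitarymx_trC_mul (C : numClosedFieldType) n (U : 'M[C]_n) :
  U \is unitarymx -> U^t* *m U = 1%:M.
Proof. by move=> uU; rewrite -invmx_unitary // mulVmx ?unitarymx_unit. Qed.

(** Left multiplication by [U] leaves the rows below [k] unchanged, so these rows of [U^t*] are
    those of [U *m U^t* = 1]. Hence the condition on rows in [fixes_below] also controls the
    columns. *)
Lemma fixes_below_trC (C : numClosedFieldType) n k (U : 'M[C]_n.+1) :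
  fixes_below k U -> fixes_below k (U^t*).
Proof.
move=> fU; have [uU _] := fU; split; first by rewrite trmxC_unitary.
move=> i j ik; rewrite -(mul_fixes_below_l _ _ fU) //.
by move/unitarymxP: uU => ->; rewrite mxE.
Qed.

Lemma fixes_below_ladder_from (C : numClosedFieldType) n (G : nat -> 'M[C]_n.+1)
    s k m :
  (forall j, fixes_below j (G j)) -> fixes_below k (ladder_from G s k m).
Proof.
move=> fG; elim: m k => [|m IHm] k //=.
have {}IHm := fixes_below_le (leqnSn k) (IHm k.+1).
by case: (s k); apply: fixes_belowM.
Qed.

(** Unitary similarity that respects the first basis vector, written as an intertwining relation so
    that no inverse appears. *)
Definition pointed_similar (C : numClosedFieldType) n (A B : 'M[C]_n.+1) :=
  exists2 U, fixes_below 1 U & U * A = B * U.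

Lemma pointed_similar_trans (C : numClosedFieldType) n (A B D : 'M[C]_n.+1) :
  pointed_similar A B -> pointed_similar B D -> pointed_similar A D.
Proof.
move=> [U fU UA] [W fW WB]; exists (W * U); first exact: fixes_belowM.
by rewrite -mulrA UA !mulrA WB.
Qed.

Lemma pointed_similar_refl (C : numClosedFieldType) n (A : 'M[C]_n.+1) :
  pointed_similar A A.
Proof. by exists 1; rewrite ?mul1r ?mulr1 //; apply: fixes_below1. Qed.

Lemma pointed_similar_sym (C : numClosedFieldType) n (A B : 'M[C]_n.+1) :
  pointed_similar A B -> pointed_similar B A.
Proof.
move=> [U fU UA]; exists (U^t*); first exact: fixes_below_trC.
have [uU _] := fU; have UU : U^t* * U = 1 by apply: unitarymx_trC_mul.
have UU' : U * U^t* = 1 by apply/unitarymxP.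
by rewrite -[LHS]mulr1 -UU' -mulrA [B * _]mulrA -UA -mulrA mulrA mulrA UU mul1r.
Qed.

Lemma ladder_flip (C : numClosedFieldType) n (G : nat -> 'M[C]_n.+1) s s' N k :
  (forall j, fixes_below j (G j)) ->
  (forall i j, (i.+1 < j)%N -> GRing.comm (G i) (G j)) ->
  (k < N)%N -> (forall j, j != k -> s j = s' j) ->
  pointed_similar (ladder G s N) (ladder G s' N).
Proof.
(* This writes [N] as [(k + m).+1], so that the ladder splits exactly at the bit [k]. Neither block
   reads that bit, so both are the same for [s] and [s']. *)
move=> fG commG /subnK; rewrite addnC addSn => <- ss'.
rewrite !ladder_split //.
have -> : ladder G s' k = ladder G s k.
  by apply: eq_ladder => j jk; rewrite ss' // ltn_eqF.
have -> m : ladder_from G s' k.+1 m = ladder_from G s k.+1 m.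
  by apply: eq_ladder_from => j jk; rewrite ss' // gtn_eqF.
set B := ladder_from _ _ _ _; set T := ladder _ _ _.
have BT : pointed_similar (T * B) (B * T).
  (* [B * (T * B) = (B * T) * B]. All factors of [B] have index at least [k.+1 >= 1], so [B] fixes
     the first coordinate. *)
  exists B; last by rewrite mulrA.
  exact: fixes_below_le (fixes_below_ladder_from _ _ _ fG).
case: (s k); case: (s' k) => //; try exact: pointed_similar_refl.
exact: pointed_similar_sym.
Qed.

Lemma ladder_similar (C : numClosedFieldType) n (G : nat -> 'M[C]_n.+1) s s' N :
  (forall j, fixes_below j (G j)) ->
  (forall i j, (i.+1 < j)%N -> GRing.comm (G i) (G j)) ->
  pointed_similar (ladder G s N) (ladder G s' N).
Proof.
move=> fG commG.
(* Induction on the number [m] of leading bits in which the two shapes may still differ. *)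
suff H m : (m <= N)%N -> forall t, (forall j, (m <= j)%N -> t j = s' j) ->
    pointed_similar (ladder G t N) (ladder G s' N).
  (* Bits from position [N] on do not enter the ladder and may be replaced by those of [s']. *)
  pose t j := if (j < N)%N then s j else s' j.
  have -> : ladder G s N = ladder G t N by apply: eq_ladder => j; rewrite /t => ->.
  by apply: (H N) => // j; rewrite /t ltnNge => ->.
elim: m => [|m IHm] mN t ts'.
  by rewrite (@eq_ladder _ _ _ s') => [|j _]; [exact: pointed_similar_refl|exact: ts'].
(* Bit [m] is corrected to its value in [s']; a single flip leads from [t] to [t'], and [t'] agrees
   with [s'] from [m] on. *)
pose t' j := if j == m then s' m else t j.
apply: (@pointed_similar_trans _ _ _ (ladder G t' N)).
  by apply: (@ladder_flip _ _ _ _ _ _ m) => // j; rewrite /t' => /negbTE ->.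
apply: IHm; first exact: ltnW.
move=> j mj; rewrite /t'; case: eqVneq => [->//|jm].
by apply: ts'; rewrite ltn_neqAle eq_sym jm.
Qed.

(** * Givens matrices and the phase, and the snake as their ladder *)

Lemma givensE (R : realType) n (a : R[i]) (i h k j : 'I_n.+1) :
  j = k.+1 :> nat ->
  givens n a k i h =
    if i == k then (if h == k then a^* else if h == j then rho a else 0)
    else if i == j then (if h == k then rho a else if h == j then - a else 0)
    else (i == h)%:R.
Proof.
move=> jk; have jNk : (j == k) = false by rewrite -val_eqE /= jk gtn_eqF.
rewrite mxE -jk !(val_eqE i) !(val_eqE h).
have [-> | ik] := eqVneq i k.
  rewrite [k == j]eq_sym jNk /=.
  by case: eqVneq => //= hk; case: eqVneq => // _; rewrite eq_sym (negbTE hk).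
have [-> /= | //] := eqVneq i j.
case: eqVneq => //= hk; case: eqVneq => //.
Qed.

Lemma mul_givens (R : realType) n p (a : R[i]) (i k j : 'I_n.+1) (l : 'I_p)
    (M : 'M[R[i]]_(n.+1, p)) :
  j = k.+1 :> nat ->
  (givens n a k *m M) i l =
    if i == k then a^* * M k l + rho a * M j l
    else if i == j then rho a * M k l - a * M j l
    else M i l.
Proof.
move=> jk; have jNk : j != k by rewrite -val_eqE /= jk gtn_eqF.
rewrite mxE; under eq_bigr => h _ do rewrite (givensE _ _ _ jk).
have sum2 (F : 'I_n.+1 -> R[i]) : (forall h, h != k -> h != j -> F h = 0) ->
    \sum_h F h = F k + F j.
  move=> F0; rewrite (bigD1 k) //= (bigD1 j) //= big1 ?addr0 // => h /andP[hk hj].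
  exact: F0.
case: (eqVneq i k) => ik; last case: (eqVneq i j) => ij.
- rewrite sum2 ?eqxx ?(negbTE jNk) // => h hk hj.
  by rewrite (negbTE hk) (negbTE hj) mul0r.
- rewrite sum2 ?eqxx ?(negbTE jNk) ?mulNr // => h hk hj.
  by rewrite (negbTE hk) (negbTE hj) mul0r.
rewrite (bigD1 i) //= eqxx mul1r big1 ?addr0 // => h hi.
by rewrite eq_sym (negbTE hi) mul0r.
Qed.

Lemma sqr_rho (R : realType) (a : R[i]) : rho a * rho a = 1 - a * a^*.
Proof. by rewrite -expr2 sqrtCK normCK. Qed.

Lemma rho_gt0 (R : realType) (a : R[i]) : `|a| < 1 -> 0 < rho a.
Proof. by move=> a1; rewrite sqrtC_gt0 subr_gt0 expr_lt1. Qed.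

Lemma conj_rho (R : realType) (a : R[i]) : `|a| < 1 -> (rho a)^* = rho a.
Proof. by move=> a1; apply/conj_Creal/ger0_real/ltW/rho_gt0. Qed.

Lemma givens_unitary (R : realType) n (a : R[i]) (k j : 'I_n.+1) :
  j = k.+1 :> nat -> `|a| < 1 -> givens n a k \is unitarymx.
Proof.
move=> jk a1; have jNk : (j == k) = false by rewrite -val_eqE /= jk gtn_eqF.
have kNj : (k == j) = false by rewrite eq_sym.
have r2 := sqr_rho a; have cr := conj_rho a1.
apply/unitarymxP/matrixP => i l; rewrite (mul_givens _ _ _ _ jk).
have E x : (givens n a k)^t* x l = (givens n a k l x)^* by rewrite !mxE.
rewrite !{}E !(givensE _ _ _ jk) !eqxx jNk mxE.
(* The positions of [i] and [l] relative to [k] and [j] are separated. The entries then reduce to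
   ring identities once [rho a] is known to be real with square [1 - a * a^*]. *)
case: (eqVneq i k) => ik; last case: (eqVneq i j) => ij;
  (case: (eqVneq l k) => lk; last case: (eqVneq l j) => lj);
  rewrite ?ik ?ij ?lk ?lj ?eqxx ?jNk ?kNj ?[_ == l]eq_sym ?(negbTE ik)
    ?(negbTE ij) ?(negbTE lk) ?(negbTE lj) ?rmorphN ?conjCK ?cr ?rmorph0 /= ?r2.

all: by rewrite ?conjC_nat //; ring.
Qed.

Lemma givens_fixes_below (R : realType) n (a : R[i]) (k j : 'I_n.+1) :
  j = k.+1 :> nat -> `|a| < 1 -> fixes_below k (givens n a k).
Proof.
move=> jk a1; split=> [|i l ik]; first exact: givens_unitary jk a1.
by rewrite (givensE _ _ _ jk) -(val_eqE i k) -(val_eqE i j) /= jk !ltn_eqF ?leqW.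
Qed.

Lemma comm_givens (R : realType) n (a b : R[i]) (k k' j j' : 'I_n.+1) :
  j = k.+1 :> nat -> j' = k'.+1 :> nat -> (j < k')%N ->
  GRing.comm (givens n a k) (givens n b k').
Proof.
move=> jk jk' jk'lt.
have [kk' kj' jk'N jj'] : [/\ k != k', k != j', j != k' & j != j'].
  by rewrite -!val_eqE /=; split; apply/eqP; lia.
(* With an arbitrary [M] on the right, both sides are computed as row operations, without sums over
   matrix entries. Taking [M = 1] gives the claim. *)
suff H (M : 'M[R[i]]_n.+1) : givens n a k *m (givens n b k' *m M) =
    givens n b k' *m (givens n a k *m M).
  by have := H 1; rewrite !mulmx1.
apply/matrixP => i l; rewrite !(mul_givens _ _ _ _ jk) !(mul_givens _ _ _ _ jk').
rewrite !(negbTE kk') !(negbTE kj') !(negbTE jk'N) !(negbTE jj').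
rewrite !(mul_givens _ _ _ _ jk).
rewrite ![k' == _]eq_sym ![j' == _]eq_sym.
rewrite !(negbTE kk') !(negbTE kj') !(negbTE jk'N) !(negbTE jj').
case: (eqVneq i k) => [->|ik]; first by rewrite (negbTE kk') (negbTE kj').
by case: (eqVneq i j) => [->|ij //]; rewrite (negbTE jk'N) (negbTE jj').
Qed.

Lemma mul_phase (R : realType) n p theta (M : 'M[R[i]]_(n.+1, p)) i l :
  (phase n theta *m M) i l = (if i == ord_max then expi theta else 1) * M i l.
Proof. by rewrite mul_diag_mx !mxE. Qed.

Lemma expi_conj (R : realType) (theta : R) : expi theta * (expi theta)^* = 1.
Proof. by rewrite -normCK normc_def /= cos2Dsin2 sqrtr1 expr1n. Qed.

Lemma phase_fixes_below (R : realType) n (theta : R) :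
  fixes_below n (phase n theta).
Proof.
split=> [|i j i_lt]; last by rewrite !mxE -val_eqE /= ltn_eqF.
apply/unitarymxP/matrixP => i l; rewrite mul_phase !mxE.
case: (eqVneq l i) => [->|]; last by rewrite mulr0n rmorph0 mulr0.
by case: ifP => _; rewrite mulr1n ?expi_conj // conjC1 mulr1.
Qed.

Lemma comm_phase (R : realType) n (a : R[i]) theta (k j : 'I_n.+1) :
  j = k.+1 :> nat -> (j < n)%N -> GRing.comm (givens n a k) (phase n theta).
Proof.
move=> jk jn; have [kN jN] : k != ord_max /\ j != ord_max.
  by rewrite -!val_eqE /=; split; apply/eqP; lia.
suff H (M : 'M[R[i]]_n.+1) : givens n a k *m (phase n theta *m M) =
    phase n theta *m (givens n a k *m M).
  by have := H 1; rewrite !mulmx1.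
apply/matrixP => i l.
rewrite mul_phase !(mul_givens _ _ _ _ jk) !mul_phase (negbTE kN) (negbTE jN).
case: (eqVneq i k) => [->|ik]; first by rewrite (negbTE kN) !mul1r.
by case: (eqVneq i j) => [->|//]; rewrite (negbTE jN) !mul1r.
Qed.

(* The phase plays the role of the factor of index n.  Past it, the value 1 keeps
   comm_factor true for all indices. *)
Definition factor (R : realType) n theta (alpha : n.-tuple R[i]) (k : nat) :
    'M[R[i]]_n.+1 :=
  if (k < n)%N then givens n alpha`_k k else if k == n then phase n theta else 1.

(** The last multiplication by the phase is the ladder step of index [n], governed by the bit at
    position [n.-1]. The auxiliary [prodE] stops at [k < n], because at index [n] [snake_prod] would
    read a default Schur parameter where the ladder has the phase. *)
Lemma snakeE (R : realType) n theta (alpha : n.-tuple R[i]) (s : n.-tuple bool) :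
  snake theta alpha s = ladder (factor theta alpha) (nth false s) n.
Proof.
have prodE k : (k < n)%N ->
    snake_prod alpha s k = ladder (factor theta alpha) (nth false s) k.
  elim: k => [|k IHk] kn /=; first by rewrite /factor kn.
  by rewrite IHk ?(ltnW kn) // /factor kn.
case: n theta alpha s prodE => [//|n] theta alpha s prodE.
have factorn : factor theta alpha n.+1 = phase n.+1 theta.
  by rewrite /factor ltnn eqxx.
by rewrite /snake /= prodE // factorn.
Qed.

Lemma factor_givens (R : realType) n theta (alpha : n.-tuple R[i]) k :
  (k < n)%N -> exists p q : 'I_n.+1,
    [/\ p = k :> nat, q = p.+1 :> nat & factor theta alpha k = givens n alpha`_k p].
Proof.
move=> kn; exists (inord k), (inord k.+1).
by rewrite !inordK // ?ltnS 1?ltnW // /factor kn.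
Qed.

Lemma factor_fixes_below (R : realType) n theta (alpha : n.-tuple R[i]) :
  (forall k : 'I_n, `|tnth alpha k| < 1) ->
  forall k, fixes_below k (factor theta alpha k).
Proof.
move=> alpha1 k; case: (ltnP k n) => [kn|nk].
  have [p [q [pk qp ->]]] := factor_givens theta alpha kn.
  rewrite -{1}pk; apply: (givens_fixes_below qp).
  by have := alpha1 (Ordinal kn); rewrite (tnth_nth 0).
rewrite /factor ltnNge nk /=; case: eqP => [->|_]; first exact: phase_fixes_below.
exact: fixes_below1.
Qed.

Lemma comm_factor (R : realType) n theta (alpha : n.-tuple R[i]) i j :
  (i.+1 < j)%N -> GRing.comm (factor theta alpha i) (factor theta alpha j).
Proof.
move=> ij; case: (ltnP j n) => [jn|nj].
  have [p [q [pi qp ->]]] := factor_givens theta alpha (ltn_trans (ltnW ij) jn).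
  have [p' [q' [pj qp' ->]]] := factor_givens theta alpha jn.
  by apply: (comm_givens _ _ qp qp'); rewrite qp pi pj.
rewrite {2}/factor ltnNge nj /=; case: eqP => [jn|_]; last exact: commr1.
have [p [q [pi qp ->]]] := factor_givens theta alpha (leq_trans (ltnW ij) (eq_leq jn)).
by apply: (comm_phase _ _ qp); rewrite qp pi -jn.
Qed.

(** * Eigenvectors with zero first component, for the zero shape *)

Lemma ladderE (R : pzRingType) (G : nat -> R) s n :
  (forall i j, (i.+1 < j)%N -> GRing.comm (G i) (G j)) ->
  ladder G s n = ladder_from G s 0 n.
Proof. by case: n => [//|n] commG; rewrite -[n]add0n ladder_split. Qed.

(** Let [y] be the tail from [k.+1] applied to [x]; it agrees with [x] up to coordinate [k], hence
    vanishes there. Row [k] of the eigenvalue equation becomes [rho * y_(k+1) = 0], so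
    [y_(k+1) = 0]. The Givens matrix of index [k] then acts trivially on [y], which leaves
    [y = lambda *: x]. This is the same equation for the shorter tail, and [lambda != 0] gives one
    more zero coordinate of [x]. *)
Lemma ladder_from_eigenvector_eq0 (R : realType) n theta (alpha : n.-tuple R[i])
    lambda (x : 'cV[R[i]]_n.+1) k m :
  (forall k : 'I_n, `|tnth alpha k| < 1) -> lambda != 0 -> (k + m)%N = n ->
  (forall i : 'I_n.+1, (i <= k)%N -> x i 0 = 0) ->
  ladder_from (factor theta alpha) xpred0 k m *m x = lambda *: x -> x = 0.
Proof.
move=> alpha1 l0; elim: m k => [|m IHm] k kmn x0.
  (* Here [k = n], so the assumed zeros already cover every coordinate. *)
  move=> _; apply/matrixP => i j; rewrite ord1 mxE x0 //.
  by rewrite -[k]addn0 kmn -ltnS.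
have kn : (k < n)%N by rewrite -kmn -addSnnS leq_addr.
rewrite /= -mulmxE -mulmxA; set y := (ladder_from _ _ _ _ *m x).
have y0 (i : 'I_n.+1) : (i <= k)%N -> y i 0 = 0.
  move=> ik; rewrite (mul_fixes_below_l (k := k.+1)) ?x0 //.
  exact/fixes_below_ladder_from/factor_fixes_below.
have [p [q [pk qp ->]]] := factor_givens theta alpha kn.
have qNp : (q == p) = false by rewrite -val_eqE /= qp gtn_eqF.
have rho_n0 : rho alpha`_k != 0.
  by rewrite gt_eqF ?rho_gt0 //; have := alpha1 (Ordinal kn); rewrite (tnth_nth 0).
move=> /matrixP Gy.
have yq : y q 0 = 0.
  have := Gy p 0; rewrite (mul_givens _ _ _ _ qp) eqxx [in RHS]mxE x0 ?pk // (y0 p) ?pk //.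
  by rewrite !mulr0 add0r => /eqP; rewrite mulf_eq0 (negbTE rho_n0) => /eqP.
have yE : y = lambda *: x.
  apply/matrixP => i j; rewrite -Gy (mul_givens _ _ _ _ qp) ord1.
  case: eqVneq => [->|_]; first by rewrite yq (y0 p) ?pk // !mulr0 addr0.
  by case: eqVneq => [->|//]; rewrite yq (y0 p) ?pk // !mulr0 subr0.
apply: (IHm k.+1 _ _ yE); first by rewrite addSnnS.
move=> i; rewrite leq_eqVlt => /orP[/eqP ik|]; last exact: x0.
have -> : i = q by apply/val_inj; rewrite /= qp pk.
by move/matrixP: yE => /(_ q 0) /esym/eqP; rewrite yq mxE mulf_eq0 (negbTE l0) => /eqP.
Qed.

(** * Normalized eigenvectors: transfer, existence and uniqueness *)

Lemma normalized_eigenvectorP (R : realType) n (A : 'M[R[i]]_n.+1) lambda x :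
  normalized_eigenvector A lambda x ->
  [/\ A *m x = lambda *: x, x^t* *m x = 1%:M & 0 < x 0 0].
Proof.
move=> [d [V [j [[AV VV V0] <- <-]]]]; split; rewrite ?mxE //.
apply/matrixP => i l; rewrite !ord1 mxE.
have /matrixP/(_ j j) := VV; rewrite !mxE !eqxx => <-.
by apply: eq_bigr => h _; rewrite !mxE.
Qed.

Lemma normalized_eigenvector_transfer (R : realType) n (A B U : 'M[R[i]]_n.+1)
    lambda x :
  fixes_below 1 U -> U *m A = B *m U ->
  normalized_eigenvector A lambda x -> normalized_eigenvector B lambda (U *m x).
Proof.
move=> fU UA [d [V [j [[AV VV V0] dj <-]]]]; have [uU _] := fU.
exists d, (U *m V), j; split=> //; last by rewrite !colE mulmxA.
split=> [l||l]; last by rewrite (mul_fixes_below_l _ _ fU).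
  have -> : col l (U *m V) = U *m col l V by rewrite !colE mulmxA.
  by rewrite mulmxA -[B *m U]UA -mulmxA AV scalemxAr.
rewrite trmx_mul map_mxM mulmxA -(mulmxA _ _ U) unitarymx_trC_mul //.
by rewrite mulmx1.
Qed.

Lemma unique_normalized_eigenvector_transfer (R : realType) n
    (A B : 'M[R[i]]_n.+1) lambda x :
  pointed_similar A B -> unique (normalized_eigenvector A lambda) x ->
  exists2 y, unique (normalized_eigenvector B lambda) y & y 0 0 = x 0 0.
Proof.
move=> [U fU UA] [Ax uniq_x]; exists (U *m x); last first.
  by rewrite (mul_fixes_below_l _ _ fU).
split=> [|y By]; first exact: normalized_eigenvector_transfer fU UA Ax.
have [uU _] := fU; have UU : U *m U^t* = 1%:M by apply/unitarymxP.
have UB : U^t* *m B = A *m U^t*.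
  rewrite -[LHS]mulmx1 -UU mulmxA -[U^t* *m B *m U]mulmxA -[B *m U]UA.
  by rewrite [U * A]/(U *m A) !mulmxA unitarymx_trC_mul // mul1mx.
rewrite (uniq_x (U^t* *m y)); first by rewrite mulmxA UU mul1mx.
exact: normalized_eigenvector_transfer (fixes_below_trC fU) UB By.
Qed.

(** [eigenvalue] is defined through row vectors, so the eigenvector is transported by right
    multiplication with [U^t*], unlike the columns above. *)
Lemma pointed_similar_eigenvalue (R : realType) n (A B : 'M[R[i]]_n.+1) lambda :
  pointed_similar A B -> eigenvalue A lambda -> eigenvalue B lambda.
Proof.
move=> [U [uU _] UA] /eigenvalueP[v vA v0].
have UU := unitarymx_trC_mul uU; have UU' : U *m U^t* = 1%:M by apply/unitarymxP.
apply/eigenvalueP; exists (v *m U^t*); last first.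
  apply: contraNneq v0 => vU0.
  by rewrite -[v]mulmx1 -UU mulmxA vU0 mul0mx.
rewrite scalemxAl -vA -!mulmxA; congr (_ *m _).
rewrite -[LHS]mulmx1 -UU' mulmxA -[U^t* *m B *m U]mulmxA.
by rewrite -[B *m U]UA [U * A]/(U *m A) mulmxA UU mul1mx.
Qed.

(** Since no eigenvector has zero first component, two eigenvectors for [lambda] are proportional,
    and every vector of an orthonormal eigenbasis can be rotated so that its first component is
    positive. *)
Lemma exists_unique_normalized_eigenvector (R : realType) n
    (A : 'M[R[i]]_n.+1) lambda :
  A \is unitarymx ->
  (forall mu (x : 'cV_n.+1), A *m x = mu *: x -> x 0 0 = 0 -> x = 0) ->
  eigenvalue A lambda -> exists x, unique (normalized_eigenvector A lambda) x.
Proof.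
move=> uA A0 /eigenvalueP[v vA v0].
suff [x Ax] : exists x, normalized_eigenvector A lambda x.
  exists x; split=> // y /normalized_eigenvectorP[Ay yy y00].
  have {Ax} [Ax xx x00] := normalized_eigenvectorP Ax.
  (* This combination solves the same eigenvalue equation and has first component zero. *)
  have /eqP : y 0 0 *: x - x 0 0 *: y = 0.
    apply: (A0 lambda); last by rewrite !mxE mulrC subrr.
    rewrite mulmxBr -!scalemxAr Ax Ay scalerBr !scalerA.
    by rewrite ![lambda * _]mulrC.
  rewrite subr_eq0 => /eqP xy.
  pose c := y 0 0 / x 0 0.
  have c0 : 0 < c by rewrite divr_gt0.
  have yE : y = c *: x.
    rewrite /c mulrC -scalerA xy scalerA mulVf ?scale1r //.
    by rewrite gt_eqF.
  (* Both vectors have norm 1, so [c] has modulus 1; being positive, it equals 1. *)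
  have : c * c^* = 1.
    have ctrZ : (c *: x)^t* = c^* *: x^t*.
      by apply/matrixP => i l; rewrite !mxE rmorphM.
    move: yy; rewrite yE ctrZ -scalemxAl -scalemxAr xx.
    by rewrite scalerA mulrC => /matrixP/(_ 0 0); rewrite !mxE eqxx mulr1.
  rewrite -normCK gtr0_norm // => /eqP; rewrite sqrf_eq1 => /orP[/eqP c1|/eqP c1].
    by rewrite yE c1 scale1r.
  by move: c0; rewrite c1 oppr_gt0 ltr10.
(* Existence: by the spectral theorem the columns of [P^t*] form an orthonormal eigenbasis of
   [A]. *)
have /orthomx_spectralP AE : A \is normalmx.
  by apply/normalmxP; rewrite unitarymx_trC_mul //; apply/unitarymxP.
set P := spectralmx A in AE; set sp := spectral_diag A in AE.
have uP : P \is unitarymx by apply: spectral_unitarymx.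
rewrite invmx_unitary // in AE.
have PP : P *m P^t* = 1%:M by apply/unitarymxP.
have PP' := unitarymx_trC_mul uP.
have AP : A *m P^t* = P^t* *m diag_mx sp by rewrite AE -!mulmxA PP mulmx1.
have AcolP j : A *m col j (P^t*) = sp 0 j *: col j (P^t*).
  rewrite {1}colE mulmxA AP; apply/matrixP => i l.
  by rewrite -colE mul_mx_diag !mxE mulrC.
have P00 j : P^t* 0 j != 0.
  apply/eqP => Pj0.
  have /matrixP Pcol : col j (P^t*) = 0 by apply: A0 (AcolP j) _; rewrite mxE.
  have /matrixP/(_ j j)/eqP := PP; rewrite mxE [_%:M j j]mxE eqxx big1 => [|h _].
    by rewrite eq_sym oner_eq0.
  by have := Pcol h 0; rewrite [LHS]mxE => ->; rewrite mxE mulr0.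
(* Unimodular factors that turn each first component [z] into its modulus. *)
pose c := \row_j ((P^t* 0 j)^* / `|P^t* 0 j|) : 'rV[R[i]]_n.+1.
have cN j : (c 0 j)^* * c 0 j = 1.
  rewrite -normCKC mxE normrM normfV normr_id norm_conjC divff ?expr1n //.
  by rewrite normr_eq0.
have c_gt0 j : 0 < P^t* 0 j * c 0 j.
  by rewrite [c 0 j]mxE mulrA -normCK expr2 mulfK ?normr_gt0 ?normr_eq0.
clearbody c.
have [j spj] : exists j, sp 0 j = lambda.
  (* In the eigenbasis the row eigenvector [v] becomes [w], with [w *m diag_mx sp = lambda *: w];
     any nonzero coordinate of [w] locates [lambda] on the diagonal. *)
  pose w := v *m P^t*.
  have /rV0Pn[j wj0] : w != 0.
    apply: contraNneq v0 => w0.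
    by rewrite -[v]mulmx1 -PP' mulmxA -/w w0 mul0mx.
  exists j; apply: (mulfI wj0).
  have /matrixP/(_ 0 j) : w *m diag_mx sp = lambda *: w.
    by rewrite -mulmxA -AP mulmxA vA scalemxAl.
  by rewrite mul_mx_diag mxE [RHS]mxE mulrC => ->; rewrite mulrC.
have colV l : col l (P^t* *m diag_mx c) = c 0 l *: col l (P^t*).
  by apply/matrixP => h m; rewrite mul_mx_diag !mxE mulrC.
exists (col j (P^t* *m diag_mx c)), (sp 0), (P^t* *m diag_mx c), j.
split=> //; split=> [l||l].
- by rewrite colV -scalemxAr AcolP scalerA mulrC -scalerA.
- rewrite trmx_mul map_mxM mulmxA -(mulmxA _ _ (P^t*)) trmxCK PP mulmx1.
  apply/matrixP => h m; rewrite mul_mx_diag !mxE.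
  case: (eqVneq m h) => [->|_]; first by rewrite mulr1n cN.
  by rewrite mulr0n rmorph0 mul0r.
- by rewrite mul_mx_diag mxE.
Qed.

Theorem proposition13 (R : realType) (n : nat) (theta : R)
    (alpha : n.-tuple R[i]) (alpha_lt1 : forall k : 'I_n, `|tnth alpha k| < 1)
    (s s' : n.-tuple bool) :
  (forall lambda : R[i],
     eigenvalue (snake theta alpha s) lambda
     <-> eigenvalue (snake theta alpha s') lambda) /\
  (forall lambda : R[i], eigenvalue (snake theta alpha s) lambda ->
     exists x x' : 'cV[R[i]]_n.+1,
       [/\ unique (normalized_eigenvector (snake theta alpha s) lambda) x,
           unique (normalized_eigenvector (snake theta alpha s') lambda) x'
         & x ord0 ord0 = x' ord0 ord0]).
Proof.
have fG := factor_fixes_below theta alpha_lt1.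
have commG := @comm_factor R n theta alpha.
pose H := ladder (factor theta alpha) xpred0 n.
have simH t : pointed_similar (snake theta alpha t) H.
  by rewrite snakeE; apply: ladder_similar.
have simHr t := pointed_similar_sym (simH t).
split=> [lambda|lambda /(pointed_similar_eigenvalue (simH s)) eigH].
  by split=> /(pointed_similar_eigenvalue (simH _)) /pointed_similar_eigenvalue; apply.
have HE : H = ladder_from (factor theta alpha) xpred0 0 n by apply: ladderE.
have uH : H \is unitarymx.
  by rewrite HE; case: (fixes_below_ladder_from xpred0 0 n fG).
have H0 mu (x : 'cV_n.+1) : H *m x = mu *: x -> x 0 0 = 0 -> x = 0.
  (* The value [mu = 0] is treated apart: there [H *m x = 0], and [H] is unitary. *)
  have [->|mu0] := eqVneq mu 0.
    rewrite scale0r => Hx _.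
    by rewrite -[x]mul1mx -(unitarymx_trC_mul uH) -mulmxA Hx mulmx0.
  rewrite HE => Hx x0.
  apply: (ladder_from_eigenvector_eq0 alpha_lt1 mu0 _ _ Hx) => // i.
  by rewrite leqn0 => /eqP i0; have -> : i = 0 by apply/val_inj.
(* The eigenvectors for [s] and [s'] are both transported from the same [x0] of [H], so each first
   component equals that of [x0]. *)
have [x0 x0_uniq] := exists_unique_normalized_eigenvector uH H0 eigH.
have [x x_uniq x_x0] := unique_normalized_eigenvector_transfer (simHr s) x0_uniq.
have [x' x'_uniq x'_x0] := unique_normalized_eigenvector_transfer (simHr s') x0_uniq.
by exists x, x'; split; rewrite // x_x0 x'_x0.
Qed.
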